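(* Let $G$ be a graph of order $n\geq 7$ and let $\overline{G}$ be its complement. Then $$\|G\|_{*}+\|\overline{G}\|_{*}\leq (n-1)\left(1+\sqrt{n}\right),$$ with equality holding if and only if $G$ is a conference graph.
   Context: Graphs are finite, simple and undirected; the order of a graph is its number of vertices. For a real matrix $A$, the trace norm $\|A\|_{*}$ is the sum of the singular values of $A$. For a graph $G$, $\|G\|_{*}$ denotes the trace norm of the adjacency matrix of $G$ (also known as the energy of $G$). A strongly regular graph with parameters $(n,d,\lambda,\mu)$ is a $d$-regular graph of order $n$ in which every two distinct adjacent vertices have exactly $\lambda$ common neighbours and every two distinct nonadjacent vertices have exactly $\mu$ common neighbours. A conference graph of order $n$ is a strongly regular graph with parameters $\left(n,(n-1)/2,(n-5)/4,(n-1)/4\right)$. *)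

(* Defs.v *)
From mathcomp Require Import all_boot all_order all_algebra.
From mathcomp Require Import polyrcf.

Set Implicit Arguments.
Unset Strict Implicit.
Unset Printing Implicit Defensive.

Import Order.TTheory GRing.Theory Num.Theory.
Local Open Scope ring_scope.

(* Square roots of the eigenvalues of A^T A, listed with algebraic            *)
(* multiplicity.  As A^T A is symmetric positive semidefinite, its            *)
(* characteristic polynomial splits over R, so the list has n entries; if     *)
(* m < n, these are the usual m singular values and n - m further zeros,      *)
(* which do not affect the sum.                                               *)
Definition singular_values (R : rcfType) (m n : nat) (A : 'M[R]_(m, n)) :
    seq R :=
  let p := char_poly (A^T *m A) in
  flatten [seq nseq (mup x p) (Num.sqrt x) | x <- rootsR p].

Definition trace_norm (R : rcfType) (m n : nat) (A : 'M[R]_(m, n)) : R :=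
  \sum_(s <- singular_values A) s.

Record sgraph := SGraph {
  vertex : finType;
  adj : rel vertex;
  adj_sym : symmetric adj;
  adj_irrefl : irreflexive adj
}.
Arguments adj : clear implicits.

Definition graph_order (G : sgraph) : nat := #|vertex G|.

Definition compl_adj (G : sgraph) : rel (vertex G) :=
  fun u v => (u != v) && ~~ adj G u v.

Lemma compl_adj_sym (G : sgraph) : symmetric (@compl_adj G).
Proof. by move=> u v; rewrite /compl_adj eq_sym adj_sym. Qed.

Lemma compl_adj_irrefl (G : sgraph) : irreflexive (@compl_adj G).
Proof. by move=> u; rewrite /compl_adj eqxx. Qed.

Definition complement (G : sgraph) : sgraph :=
  SGraph (@compl_adj_sym G) (@compl_adj_irrefl G).

(* Rows and columns follow the enumeration of the vertices given by enum_val.  *)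
Definition adjacency_matrix (R : rcfType) (G : sgraph) :
    'M[R]_(graph_order G) :=
  \matrix_(i, j) (adj G (enum_val i) (enum_val j))%:R.

Definition graph_trace_norm (R : rcfType) (G : sgraph) : R :=
  trace_norm (adjacency_matrix R G).

Definition common_neighbours (G : sgraph) (u v : vertex G) :
    {set vertex G} :=
  [set w | adj G u w & adj G v w].

Definition regular (G : sgraph) (d : nat) : Prop :=
  forall u : vertex G, #|[set w | adj G u w]| = d.

Definition strongly_regular (G : sgraph) (n d lambda mu : nat) : Prop :=
  [/\ graph_order G = n,
      regular G d,
      forall u v : vertex G, u != v -> adj G u v ->
        #|common_neighbours u v| = lambda
    & forall u v : vertex G, u != v -> ~~ adj G u v ->
        #|common_neighbours u v| = mu].

(* The parameters (n-1)/2, (n-5)/4, (n-1)/4 are exact quotients of integers;   *)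
(* the equations avoid truncated subtraction and division on nat.              *)
Definition conference_graph (n : nat) (G : sgraph) : Prop :=
  exists d lambda mu : nat,
    [/\ strongly_regular G n d lambda mu,
        (2 * d + 1 = n)%N,
        (4 * lambda + 5 = n)%N
      & (4 * mu + 1 = n)%N].

(* Main.v *)
Require Import Defs.
From mathcomp Require Import all_boot all_order all_algebra.
From mathcomp Require Import reals.
From mathcomp Require Import polyrcf complex zify ring lra.

Set Implicit Arguments.
Unset Strict Implicit.
Unset Printing Implicit Defensive.

Import Order.TTheory GRing.Theory Num.Theory.
Local Open Scope ring_scope.

(** Let [A] and [B] be the adjacency matrices of the graph and of its
    complement, [J] the all-ones matrix, so that [A + B = J - 1], and let
    [S = A - B].  The entries of [S] off the diagonal are 1 or -1, hence
    [\tr (S *m S) = n (n - 1)].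

    For a symmetric [A] the trace norm is the maximum of [\tr (X *m A)] over
    the symmetric involutions [X] ([trace_norm_attained],
    [mxtrace_le_trace_norm]).  Choose maximizers [X] for [A] and [Y] for [B] and
    put [V = (X + Y) / 2], [U = (X - Y) / 2].  The sum of the two trace norms is
    then [\tr (V *m J) - \tr V + \tr (U *m S)], and, because [X] and [Y] are
    involutions, [V *m V + U *m U = 1] and [V *m U = - U *m V].  The last term
    is controlled by [0 <= \tr ((S - sqrt n U)^T *m (S - sqrt n U))], which
    trades it for [\tr (U *m U) = n - \tr (V *m V)].  With [c = sqrt n / 2],
    what remains to be shown is

      [\tr (V *m J) - \tr V - c (\tr (V *m V) - 1) <= n - 1]

    ([anticommuting_bound]).  Estimating [- \tr V] by the Cauchy-Schwarz
    inequality would be too weak here (it yields the theorem with [sqrt (n + 1)]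
    in place of [sqrt n]).  The point is that [U] anticommutes with [V] and is
    invertible away from the eigenvalues 1 and -1 of [V], so it exchanges the
    eigenspaces of [a] and [- a]: all eigenvalues in the open interval from -1
    to 1 cancel in [\tr V].  The inequality is then read off from the spectrum
    of [V] by cases on its largest eigenvalue ([spectrum_bound]); it is an
    equality only if [\tr (V *m J) = n] and [\tr (V *m V) = 1], that is, for
    [V = J / n].

    In the case of equality, therefore, [V = J / n] and [S = sqrt n U], so that
    [S *m S = n - J].  Conversely, if [S *m S = n - J] then [S *m J = 0], and the
    involutions [J / n + S / sqrt n] and [J / n - S / sqrt n] show that the bound
    is attained.  Finally the entries of [S *m S] are affine in degrees and
    numbers of common neighbours, and [S *m S = n - J] says exactly that the
    graph is a conference graph ([conference_graphP]).

    The singular values in the trace norm are roots of a characteristic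
    polynomial; an orthogonal diagonalization of real symmetric matrices
    ([sym_spectral]) turns the trace norm into the sum of the absolute values
    of the eigenvalues ([trace_norm_diag]). *)

(** * Orthogonal diagonalization of real symmetric matrices *)

Lemma trmxD (V : nmodType) m n (A B : 'M[V]_(m, n)) : (A + B)^T = A^T + B^T.
Proof. exact: raddfD. Qed.

Lemma trmxB (V : zmodType) m n (A B : 'M[V]_(m, n)) : (A - B)^T = A^T - B^T.
Proof. exact: raddfB. Qed.

Lemma trmxZ (R : pzRingType) m n a (A : 'M[R]_(m, n)) : (a *: A)^T = a *: A^T.
Proof. exact: linearZ. Qed.

Definition orthogonal_mx (R : rcfType) n (Q : 'M[R]_n) := Q *m Q^T = 1%:M.

Lemma orthogonal_mxC (R : rcfType) n (Q : 'M[R]_n) :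
  orthogonal_mx Q -> Q^T *m Q = 1%:M.
Proof. exact: mulmx1C. Qed.

Lemma orthogonal_mxM (R : rcfType) n (P Q : 'M[R]_n) :
  orthogonal_mx P -> orthogonal_mx Q -> orthogonal_mx (P *m Q).
Proof.
by rewrite /orthogonal_mx => PP QQ; rewrite trmx_mul mulmxA -(mulmxA P) QQ mulmx1.
Qed.

Lemma sqnorm_row (R : rcfType) n (u : 'rV[R]_n) :
  u *m u^T = (\sum_i u 0 i ^+ 2)%:M.
Proof.
rewrite [LHS]mx11_scalar mxE; congr (_%:M).
by apply: eq_bigr => i _; rewrite mxE expr2.
Qed.

Lemma sum_sqr_row_gt0 (R : rcfType) n (u : 'rV[R]_n) :
  u != 0 -> 0 < \sum_i u 0 i ^+ 2.
Proof.
move=> u_neq0; rewrite lt_neqAle sumr_ge0 ?andbT; last by move=> *; exact: sqr_ge0.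
rewrite eq_sym; apply: contraNneq u_neq0 => /psumr_eq0P s0.
apply/eqP/rowP => i; rewrite [RHS]mxE; apply/eqP.
by rewrite -sqrf_eq0; apply/eqP/s0 => // j _; exact: sqr_ge0.
Qed.

(** Over the complex numbers an eigenvalue [z] exists; evaluating [v A v^*] in
    two ways shows that [z] is its own conjugate, so it is already a root of the
    characteristic polynomial over [R]. *)
Lemma sym_eigenvalue (R : rcfType) n (A : 'M[R]_n.+1) :
  A^T = A -> exists a, eigenvalue A a.
Proof.
move=> symA; pose AC := map_mx (real_complex R) A.
have [z] := spectral.eigenvalue_closed AC (ltn0Sn n).
move=> eig_z.
have /eigenvalueP [v vA v_neq0] := eig_z.
have zreal : z^* = z.
  have hermA : map_mx Num.conj AC^T = AC.
    rewrite /AC map_trmx symA -map_mx_comp; apply/matrixP => i j.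
    by rewrite !mxE /=; congr (_ +i* _)%C; rewrite ?oppr0.
  pose vs := map_mx Num.conj v^T.
  have Avs : AC *m vs = z^* *: vs.
    by rewrite -{1}hermA -map_mxM -trmx_mul vA linearZ /= map_mxZ.
  have := mulmxA v AC vs; rewrite Avs vA -scalemxAr -scalemxAl => /matrixP/(_ 0 0).
  rewrite !mxE; apply: mulIf; apply: contraNneq v_neq0 => vv0.
  apply/eqP/rowP => i; rewrite mxE; apply/eqP; rewrite -normr_eq0 -sqrf_eq0 normCK.
  have := vv0; move/psumr_eq0P => /(_ _ i isT); rewrite !mxE => -> //.
  by move=> j _; rewrite !mxE mul_conjC_ge0.
exists (complex.Re z).
rewrite eigenvalue_root_char.
move: eig_z; rewrite eigenvalue_root_char /AC -map_char_poly.
suff -> : z = real_complex R (complex.Re z) by rewrite fmorph_root.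
case: z zreal {vA} => x y /= [] /eqP.
by rewrite eq_sym -addr_eq0 -mulr2n mulrn_eq0 /= => /eqP ->.
Qed.

(** The reflection exchanging [u] and the first basis vector extends [u] to an
    orthonormal basis. *)
Lemma householder (R : rcfType) n (u : 'rV[R]_(1 + n)) :
  u *m u^T = 1%:M -> exists2 H : 'M[R]_(1 + n), orthogonal_mx H & row 0 H = u.
Proof.
move=> uu; pose e : 'rV[R]_(1 + n) := delta_mx 0 0.
have [->|neq_ue] := eqVneq u e.
  by exists 1%:M; rewrite ?row1 // /orthogonal_mx trmx1 mulmx1.
pose w := u - e; pose s := \sum_i w 0 i ^+ 2.
have ww : w *m w^T = s%:M by rewrite sqnorm_row.
have s_neq0 : s != 0.
  by rewrite gt_eqF // sum_sqr_row_gt0 // subr_eq0.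
have ee : e *m e^T = 1%:M.
  by rewrite trmx_delta mul_delta_mx; apply/matrixP => i j; rewrite !ord1 !mxE.
have eu : e *m u^T = (u 0 0)%:M.
  by rewrite -rowE; apply/matrixP => i j; rewrite !ord1 !mxE.
have ue : u *m e^T = (u 0 0)%:M.
  by apply: trmx_inj; rewrite trmx_mul trmxK eu tr_scalar_mx.
have sE : s = 2 - 2 * u 0 0.
  have := ww; rewrite /w linearB /= mulmxBl !mulmxBr uu ue eu ee => /matrixP/(_ 0 0).
  rewrite !mxE eqxx !mulr1n => <-; ring.
exists (1%:M - (2 / s) *: (w^T *m w)).
  have symM : (w^T *m w)^T = w^T *m w by rewrite trmx_mul trmxK.
  have sqM : w^T *m w *m (w^T *m w) = s *: (w^T *m w).
    by rewrite mulmxA -(mulmxA w^T w) ww mul_mx_scalar -scalemxAl.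
  move: (w^T *m w) symM sqM => M symM sqM.
  rewrite /orthogonal_mx trmxB trmxZ symM trmx1.
  rewrite mulmxBl !mulmxBr !mul1mx mulmx1 -scalemxAl -scalemxAr sqM !scalerA.
  have -> : 2 / s * (2 / s) * s = 2 / s + 2 / s by field.
  by rewrite scalerDl opprB addrK subrK.
rewrite raddfB /= row1 [row 0 (_ *: _)]linearZ /= row_mul.
have -> : row 0 w^T = (u 0 0 - 1)%:M.
  by apply/matrixP => i j; rewrite !ord1 !mxE eqxx.
rewrite mul_scalar_mx scalerA.
have -> : 2 / s * (u 0 0 - 1) = -1.
  by apply: (mulfI s_neq0); rewrite mulrA mulrCA divff // mulr1 sE; ring.
by rewrite scaleN1r opprK /w addrC subrK.
Qed.

(** Induction on the dimension: in an orthonormal basis that starts with an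
    eigenvector, symmetry makes the matrix block diagonal. *)
Theorem sym_spectral (R : rcfType) n (A : 'M[R]_n) :
  A^T = A ->
  exists (Q : 'M[R]_n) (d : 'rV[R]_n),
    orthogonal_mx Q /\ A = Q^T *m diag_mx d *m Q.
Proof.
elim: n A => [|n IH] A symA.
  by exists 1%:M, 0; split; apply/matrixP => -[].
have [a /eigenvalueP[v vA v_neq0]] := sym_eigenvalue symA.
pose s := \sum_i v 0 i ^+ 2.
have s_gt0 : 0 < s by exact: sum_sqr_row_gt0.
pose u := (Num.sqrt s)^-1 *: v.
have uA : u *m A = a *: u by rewrite -scalemxAl vA !scalerA mulrC.
have uu : u *m u^T = 1%:M.
  rewrite trmxZ -scalemxAl -scalemxAr scalerA sqnorm_row -invfM -expr2.
  by rewrite sqr_sqrtr ?ltW // scale_scalar_mx mulVf ?gt_eqF.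
have [H orthH rowH] := householder (n := n) uu.
pose B : 'M[R]_(1 + n) := H *m A *m H^T.
have symB : B^T = B by rewrite /B !trmx_mul trmxK symA mulmxA.
have AE : A = H^T *m B *m H.
  by rewrite /B !mulmxA orthogonal_mxC // mul1mx -mulmxA orthogonal_mxC // mulmx1.
have row0B : row 0 B = a *: delta_mx 0 0.
  rewrite /B !row_mul rowH uA -scalemxAl -rowH -row_mul orthH.
  by rewrite row1.
clearbody B.
have ursub0 : ursubmx B = 0.
  apply/matrixP => i j; rewrite !ord1 [RHS]mxE.
  have := congr1 (fun M : 'rV_(1 + n) => M 0 (rshift 1 j)) row0B.
  rewrite !mxE /= mulr0 => <-; congr (B _ _); exact: val_inj.
have dlsub0 : dlsubmx B = 0.
  by rewrite -[LHS]trmxK trmx_dlsub symB ursub0 trmx0.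
have [|Q' [d' [orthQ' BE]]] := IH (drsubmx B); first by rewrite trmx_drsub symB.
pose P : 'M[R]_(1 + n) := block_mx 1%:M 0 0 Q'.
have orthP : orthogonal_mx P.
  rewrite /orthogonal_mx /P tr_block_mx !trmx0 trmx1 mulmx_block.
  by rewrite !(mulmx0, mul0mx, mulmx1, addr0, add0r) orthQ' -scalar_mx_block.
have BP : B = P^T *m diag_mx (row_mx (ulsubmx B) d') *m P.
  rewrite diag_mx_row -[LHS](submxK B) ursub0 dlsub0 BE /P tr_block_mx !trmx0 trmx1.
  rewrite !mulmx_block !(mulmx0, mul0mx, mulmx1, mul1mx, addr0, add0r).
  congr block_mx.
  by apply/matrixP => i j; rewrite !ord1 !mxE eqxx mulr1n.
exists (P *m H), (row_mx (ulsubmx B) d').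
split; first exact: orthogonal_mxM.
by rewrite [A]AE {1}BP trmx_mul !mulmxA.
Qed.

(** * The trace norm of a symmetric matrix *)

Lemma char_poly_conj (R : rcfType) n (Q A : 'M[R]_n) :
  orthogonal_mx Q -> char_poly (Q^T *m A *m Q) = char_poly A.
Proof.
move=> orthQ; pose P := map_mx polyC Q.
have PP : P^T *m P = 1%:M.
  by rewrite /P map_trmx -map_mxM orthogonal_mxC // map_mx1.
rewrite /char_poly /char_poly_mx !map_mxM -map_trmx -/P.
have -> : 'X%:M - P^T *m map_mx polyC A *m P
          = P^T *m ('X%:M - map_mx polyC A) *m P.
  by rewrite mulmxBr mulmxBl mul_mx_scalar -scalemxAl PP scalemx1.
by rewrite !det_mulmx mulrC mulrA -det_mulmx (mulmx1C PP) det1 mul1r.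
Qed.

Lemma conj_mulmx (R : rcfType) n (Q M N : 'M[R]_n) :
  orthogonal_mx Q ->
  (Q^T *m M *m Q) *m (Q^T *m N *m Q) = Q^T *m (M *m N) *m Q.
Proof. by move=> orthQ; rewrite -!mulmxA (mulmxA Q) orthQ mul1mx. Qed.

(** The product [A^T *m A] is conjugate to the diagonal matrix of the squares
    [d_i ^ 2], so its characteristic polynomial splits and the multiplicities
    [mup] count the repetitions among these squares. *)
Lemma trace_norm_diag (R : rcfType) n (Q : 'M[R]_n) (d : 'rV[R]_n) :
  orthogonal_mx Q -> trace_norm (Q^T *m diag_mx d *m Q) = \sum_i `|d 0 i|.
Proof.
move=> orthQ; set A := _ *m Q.
pose s := [seq d 0 i ^+ 2 | i <- enum 'I_n].
have pE : char_poly (A^T *m A) = \prod_(x <- s) ('X - x%:P).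
  have -> : A^T *m A = Q^T *m diag_mx (\row_i (d 0 i ^+ 2)) *m Q.
    have -> : A^T = A by rewrite /A !trmx_mul trmxK tr_diag_mx mulmxA.
    by rewrite /A conj_mulmx // mulmx_diag.
  rewrite char_poly_conj // char_poly_trig ?diag_mx_is_trig // big_map big_enum /=.
  by apply: eq_bigr => i _; rewrite !mxE eqxx.
rewrite /trace_norm /singular_values pE big_flatten /= big_map.
have p_neq0 : \prod_(x <- s) ('X - x%:P) != 0 by rewrite monic_neq0 ?monic_prod_XsubC.
transitivity (\sum_(x <- undup s) Num.sqrt x *+ count_mem x s).
  rewrite (perm_big (undup s)) /=; last first.
    apply: uniq_perm; rewrite ?undup_uniq ?uniq_roots // => x.
    rewrite mem_undup -(root_prod_XsubC s).
    by have := roots_on_rootsR p_neq0 x; rewrite in_itv /= => <-.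
  apply: eq_bigr => x _; rewrite mu_prod_XsubC.
  by rewrite big_nseq -Monoid.iteropE.
rewrite big_undup_iterop_count big_map big_enum /=.
by apply: eq_bigr => i _; rewrite sqrtr_sqr.
Qed.

Lemma mxtrace_conj (R : rcfType) n (Q M : 'M[R]_n) :
  orthogonal_mx Q -> \tr (Q^T *m M *m Q) = \tr M.
Proof. by move=> orthQ; rewrite mxtrace_mulC mulmxA orthQ mul1mx. Qed.

Lemma conj_sym (R : rcfType) n (Q M : 'M[R]_n) :
  M^T = M -> (Q^T *m M *m Q)^T = Q^T *m M *m Q.
Proof. by move=> symM; rewrite !trmx_mul trmxK symM mulmxA. Qed.

Lemma orthogonal_mxT (R : rcfType) n (Q : 'M[R]_n) :
  orthogonal_mx Q -> orthogonal_mx Q^T.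
Proof. by move=> /orthogonal_mxC; rewrite /orthogonal_mx trmxK. Qed.

Lemma orthogonal_entry_le1 (R : rcfType) n (W : 'M[R]_n) i j :
  orthogonal_mx W -> `|W i j| <= 1.
Proof.
move=> /matrixP/(_ i i); rewrite !mxE eqxx (bigD1 j) //= mxE -expr2 => row_i.
have : 0 <= \sum_(k | k != j) W i k * W^T k i.
  by apply: sumr_ge0 => k _; rewrite mxE -expr2 sqr_ge0.
rewrite -(@expr_le1 _ 2) ?normr_ge0 // real_normK ?num_real // => ge0.
by rewrite -[leRHS]mulr1n -row_i lerDl.
Qed.

(** The maximizer is the matrix sign of [A], with the sign of 0 taken to be 1
    so that it is an involution. *)
Lemma trace_norm_attained (R : rcfType) n (A : 'M[R]_n) : A^T = A ->
  exists X : 'M[R]_n, [/\ X^T = X, X *m X = 1%:M & \tr (X *m A) = trace_norm A].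
Proof.
move=> /sym_spectral [Q [d [orthQ ->]]].
pose sg : 'rV[R]_n := \row_i (-1) ^+ (d 0 i < 0)%R.
exists (Q^T *m diag_mx sg *m Q); split.
- by rewrite conj_sym // tr_diag_mx.
- rewrite conj_mulmx // mulmx_diag.
  suff -> : \row_i (sg 0 i * sg 0 i) = const_mx 1 :> 'rV[R]_n.
    by rewrite diag_const_mx mulmx1 orthogonal_mxC.
  by apply/rowP => i; rewrite !mxE -expr2 sqrr_sign.
- rewrite conj_mulmx // mxtrace_conj // mulmx_diag trace_norm_diag // mxtrace_diag.
  by apply: eq_bigr => i _; rewrite !mxE [RHS]normrEsign.
Qed.

(** In an eigenbasis of [A] the trace is a combination of the eigenvalues with
    the diagonal entries of an orthogonal matrix as coefficients. *)
Lemma mxtrace_le_trace_norm (R : rcfType) n (X A : 'M[R]_n) :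
  A^T = A -> orthogonal_mx X -> \tr (X *m A) <= trace_norm A.
Proof.
move=> /sym_spectral [Q [d [orthQ ->]]] orthX.
rewrite trace_norm_diag // !mulmxA mxtrace_mulC !mulmxA.
have orthW : orthogonal_mx (Q *m X *m Q^T).
  by do 2?apply: orthogonal_mxM => //; apply: orthogonal_mxT.
move: (_ *m X *m _) orthW => W orthW.
apply: ler_sum => i _; rewrite mul_mx_diag mxE.
rewrite (le_trans (ler_norm _)) // normrM ler_piMl //.
exact: orthogonal_entry_le1.
Qed.

(** * Anticommuting matrices whose squares add up to the identity *)

(** The situation is that of symmetric [V] and [U] with [V *m V + U *m U = 1]
    and [V *m U = - U *m V], written in an eigenbasis of [V]: the [d i] are the
    eigenvalues of [V] and [W] is the matrix of [U]. *)
Section AnticommutingSpectrum.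

Variables (R : rcfType) (n : nat) (d : 'I_n -> R) (W : 'M[R]_n).
Hypothesis symW : W^T = W.
Hypothesis antiW : forall i j, W i j != 0 -> d j = - d i.
Hypothesis row_unit : forall i, \sum_j W i j ^+ 2 = 1 - d i ^+ 2.

Lemma sqr_spectrum_le1 i : d i ^+ 2 <= 1.
Proof. by rewrite -subr_ge0 -row_unit sumr_ge0 // => j _; exact: sqr_ge0. Qed.

(** The squares [W i j ^+ 2] transport the weight of the eigenvalue [d i] to
    eigenvalues [d j = - d i]; since row [i] has total weight [1 - d i ^+ 2],
    dividing by the latter weighs each interior eigenvalue by one, and the sum
    equals its own opposite. *)
Lemma sum_interior_spectrum : \sum_(i | d i ^+ 2 != 1) d i = 0.
Proof.
(* f i is 0 when d i ^+ 2 = 1, by division by zero *)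
pose f i := d i / (1 - d i ^+ 2); pose S := \sum_i \sum_j f i * W i j ^+ 2.
have SE : \sum_(i | d i ^+ 2 != 1) d i = S.
  rewrite [S](bigID (fun i => d i ^+ 2 != 1)) /= [X in _ + X]big1 ?addr0 => [|i].
    apply: eq_bigr => i d_i.
    by rewrite -mulr_sumr row_unit /f divfK // subr_eq0 eq_sym.
  rewrite negbK => /eqP d_i; rewrite -mulr_sumr row_unit d_i.
  by rewrite subrr mulr0.
have : S = - S.
  rewrite {2}/S exchange_big -sumrN /=; apply: eq_bigr => i _.
  rewrite -sumrN; apply: eq_bigr => j _.
  have -> : W j i = W i j by rewrite -{1}symW mxE.
  rewrite /f.
  have [->|/antiW ->] := eqVneq (W i j) 0; first by rewrite expr0n !mulr0 oppr0.
  by rewrite sqrrN !mulNr opprK.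
rewrite SE; lra.
Qed.

(** The contribution of an eigenvalue to [- \tr V - c * \tr (V *m V)] once the
    interior eigenvalues have been cancelled in [\tr V]. *)
Let w (c : R) i := - (if d i ^+ 2 != 1 then 0 else d i) - c * d i ^+ 2.

Lemma sum_spectrum_weight c :
  - (\sum_i d i) - c * (\sum_i d i ^+ 2) = \sum_i w c i.
Proof.
rewrite big_split /= !sumrN -mulr_sumr; congr (- _ - _).
rewrite (bigID (fun i => d i ^+ 2 != 1)) /= sum_interior_spectrum add0r.
by rewrite big_mkcond /=; apply: eq_bigr => i _; case: eqP.
Qed.

Lemma spectrum_weight_le c i : 1 <= c -> w c i <= - (c - 1) * d i ^+ 2.
Proof.
move=> c_ge1; rewrite /w; case: eqP => [d_i|_] /=; last first.
  by have := sqr_ge0 (d i); nra.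
suff : - d i <= d i ^+ 2 by lra.
by rewrite d_i; nra.
Qed.

Lemma spectrum_weight_le0 c i : 1 <= c -> w c i <= 0.
Proof.
move=> c_ge1; apply: le_trans (spectrum_weight_le i c_ge1) _.
by have := sqr_ge0 (d i); nra.
Qed.

(** Here [g i] is the squared length of the projection of the all-ones vector on
    the [i]-th eigenvector, so that [F] is the quantity bounded in
    [anticommuting_bound].  Each eigenvalue has a nonpositive weight [w], so one
    may keep the weights of a few well-chosen eigenvalues only.  If the largest
    eigenvalue is 1, its weight [- 1 - c] suffices.  If it is some [a] strictly
    between 0 and 1, then [- a] is an eigenvalue too, and the two weights
    [- c a ^ 2] suffice.  Otherwise [\sum_i d i * g i <= 0].  The last two cases
    give a strict inequality. *)
Lemma spectrum_bound (g : 'I_n -> R) (c : R) :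
    (5 <= n)%N -> 1 < c -> 4 * c <= n%:R ->
    (forall i, 0 <= g i) -> \sum_i g i = n%:R ->
  let F := \sum_i d i * g i - \sum_i d i - c * (\sum_i d i ^+ 2 - 1) in
  F <= n%:R - 1 /\
  (F = n%:R - 1 -> \sum_i d i * g i = n%:R /\ \sum_i d i ^+ 2 = 1).
Proof.
move=> n_ge5 c_gt1 c_le g_ge0 sum_g F.
have c_ge1 := ltW c_gt1.
have n_gt4 : 5 <= n%:R :> R by rewrite ler_nat.
pose i0 := Ordinal (leq_trans (isT : 0 < 5)%N n_ge5).
pose G := \sum_i d i * g i.
have FE : F = G + \sum_i w c i + c by rewrite /F -sum_spectrum_weight -/G; ring.
have [im _ d_le] := Order.TotalTheory.arg_maxP d (isT : predT i0).
have G_le : G <= d im * n%:R.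
  by rewrite -sum_g mulr_sumr ler_sum // => i _; rewrite ler_wpM2r //; exact: d_le.
have [d_le0|d_gt0] := leP (d im) 0.
  have sw : \sum_i w c i <= 0 by apply: sumr_le0 => i _; exact: spectrum_weight_le0.
  suff : F < n%:R - 1 by move=> lt; split=> [|eqF]; [exact: ltW|rewrite eqF ltxx in lt].
  rewrite FE; nra.
have d_le1 : d im <= 1 by have := sqr_spectrum_le1 im; nra.
rewrite le_eqVlt in d_le1; case/orP: d_le1 => [/eqP d_1|d_lt1].
  pose E := \sum_(i | i != im) d i ^+ 2.
  have E_ge0 : 0 <= E by apply: sumr_ge0 => i _; exact: sqr_ge0.
  have sqE : \sum_i d i ^+ 2 = 1 + E by rewrite (bigD1 im) //= d_1 expr1n.
  have sw : \sum_i w c i <= - 1 - c - (c - 1) * E.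
    rewrite (bigD1 im) //= /w d_1 expr1n eqxx /= mulr1 lerD //.
    rewrite -mulNr mulr_sumr ler_sum // => i _; exact: spectrum_weight_le.
  have FG : F <= G - 1 - (c - 1) * E by rewrite FE; lra.
  rewrite d_1 mul1r in G_le; rewrite sqE -/G.
  by split=> [|eqF]; [nra|split; nra].
(* row im of W is not zero, which provides the eigenvalue - d im *)
have [j W_j] : exists j, W im j != 0.
  apply/existsP; apply: contraT; rewrite negb_exists => /forallP W0.
  have := row_unit im; rewrite big1 => [|j _]; first by nra.
  by have := W0 j; rewrite negbK => /eqP ->; rewrite expr0n.
have d_j := antiW W_j.
have j_im : j != im by apply: contraTneq d_gt0 => eq_j; rewrite eq_j in d_j; lra.
have sw : \sum_i w c i <= - (2 * c * d im ^+ 2).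
  rewrite (bigD1 im) //= (bigD1 j) //= addrA.
  have : \sum_(i | (i != im) && (i != j)) w c i <= 0.
    by apply: sumr_le0 => i _; exact: spectrum_weight_le0.
  have d_neq1 : d im ^+ 2 != 1 by apply: contraTneq d_lt1 => ?; rewrite -leNgt; nra.
  rewrite /w d_j sqrrN d_neq1; lra.
suff : F < n%:R - 1 by move=> lt; split=> [|eqF]; [exact: ltW|rewrite eqF ltxx in lt].
rewrite FE.
have : 0 <= (1 - d im) * (n%:R - 2 * c * (1 + d im)).
  by apply: mulr_ge0; nra.
nra.
Qed.

End AnticommutingSpectrum.

(** The condition [1 < c] makes eigenvalues -1 of [V] a loss in [F], although
    they increase [- \tr V].  For a largest eigenvalue [a] between 0 and 1, [F] is
    at most [n * a - 2 * c * a ^ 2 + c]; the condition [4 * c <= n] makes this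
    increase with [a], up to [n - c] at [a = 1]. *)
Lemma anticommuting_bound (R : rcfType) n (V U : 'M[R]_n) (c : R) :
    V^T = V -> U^T = U -> V *m V + U *m U = 1%:M -> V *m U = - (U *m V) ->
    (5 <= n)%N -> 1 < c -> 4 * c <= n%:R ->
  let F := \tr (V *m const_mx 1) - \tr V - c * (\tr (V *m V) - 1) in
  F <= n%:R - 1 /\
  (F = n%:R - 1 -> \tr (V *m const_mx 1) = n%:R /\ \tr (V *m V) = 1).
Proof.
move=> /sym_spectral [Q [d [orthQ VE]]] symU sqVU antiVU n_ge5 c_gt1 c_le.
pose W := Q *m U *m Q^T.
have symW : W^T = W by rewrite /W !trmx_mul trmxK symU mulmxA.
have UE : U = Q^T *m W *m Q.
  by rewrite /W !mulmxA orthogonal_mxC // mul1mx -mulmxA orthogonal_mxC // mulmx1.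
clearbody W.
have QinjE (M N : 'M[R]_n) : Q^T *m M *m Q = Q^T *m N *m Q -> M = N.
  move=> /(congr1 (fun K => Q *m K *m Q^T)).
  by rewrite !mulmxA orthQ !mul1mx -!mulmxA orthQ !mulmx1.
have antiW i j : W i j != 0 -> d 0 j = - d 0 i.
  have /matrixP/(_ i j) : diag_mx d *m W = - (W *m diag_mx d).
    by apply: QinjE; rewrite mulmxN mulNmx -!conj_mulmx // -UE -VE.
  rewrite mul_diag_mx mul_mx_diag !mxE => dW W_neq0.
  by apply: (mulfI W_neq0); rewrite mulrN [W i j * d 0 i]mulrC dW opprK.
have row_unit i : \sum_j W i j ^+ 2 = 1 - d 0 i ^+ 2.
  have /matrixP/(_ i i) : diag_mx d *m diag_mx d + W *m W = 1%:M.
    apply: QinjE; rewrite mulmx1 orthogonal_mxC //.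
    by rewrite mulmxDr mulmxDl -!conj_mulmx // -UE -VE.
  rewrite mulmx_diag !mxE eqxx !mulr1n -expr2 => <-; rewrite addrAC subrr add0r.
  apply: eq_bigr => j _; rewrite expr2; congr (_ * _).
  by rewrite -{1}symW mxE.
pose y : 'cV[R]_n := Q *m const_mx 1; pose g i := y i 0 ^+ 2.
have yyE : Q *m const_mx 1 *m Q^T = y *m y^T.
  rewrite /y trmx_mul trmx_const !mulmxA; congr (_ *m _); rewrite -mulmxA.
  congr (_ *m _); apply/matrixP => i j.
  by rewrite !mxE big_ord1 !mxE mulr1.
clearbody y.
have gE i : (Q *m const_mx 1 *m Q^T) i i = g i.
  by rewrite yyE mxE big_ord1 [y^T _ _]mxE -expr2.
have sum_g : \sum_i g i = n%:R.
  have -> : \sum_i g i = \tr (Q *m const_mx 1 *m Q^T) by apply: eq_bigr => i _.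
  rewrite mxtrace_mulC mulmxA orthogonal_mxC // mul1mx /mxtrace.
  under eq_bigr => i _ do rewrite mxE.
  by rewrite sumr_const card_ord.
have -> : \tr V = \sum_i d 0 i by rewrite VE mxtrace_conj // mxtrace_diag.
have -> : \tr (V *m V) = \sum_i d 0 i ^+ 2.
  rewrite VE conj_mulmx // mxtrace_conj // mulmx_diag mxtrace_diag.
  by apply: eq_bigr => i _; rewrite mxE expr2.
have -> : \tr (V *m const_mx 1) = \sum_i d 0 i * g i.
  rewrite VE -!mulmxA mxtrace_mulC -!mulmxA (mulmxA Q).
  by apply: eq_bigr => i _; rewrite mul_diag_mx mxE gE.
by apply: (spectrum_bound symW antiW row_unit) => // i; exact: sqr_ge0.
Qed.

(** * Symmetric matrices with sum J - 1 *)

Lemma mxtrace_trmx_mul (R : rcfType) m n (M : 'M[R]_(m, n)) :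
  \tr (M^T *m M) = \sum_j \sum_i M i j ^+ 2.
Proof.
apply: eq_bigr => j _; rewrite mxE; apply: eq_bigr => i _.
by rewrite mxE expr2.
Qed.

Lemma mxtrace_trmx_mul_ge0 (R : rcfType) m n (M : 'M[R]_(m, n)) :
  0 <= \tr (M^T *m M).
Proof. by rewrite mxtrace_trmx_mul; do 2!apply: sumr_ge0 => ? _; exact: sqr_ge0. Qed.

Lemma mxtrace_trmx_mul_eq0 (R : rcfType) m n (M : 'M[R]_(m, n)) :
  \tr (M^T *m M) = 0 -> M = 0.
Proof.
rewrite mxtrace_trmx_mul => /psumr_eq0P M0; apply/matrixP => i j; rewrite mxE.
have /psumr_eq0P : \sum_i M i j ^+ 2 = 0.
  by apply: M0 => // k _; apply: sumr_ge0 => ? _; exact: sqr_ge0.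
move=> /(_ (fun k _ => sqr_ge0 _) i isT) /eqP.
by rewrite sqrf_eq0 => /eqP.
Qed.

Lemma mulmx_const1 (R : pzSemiRingType) m n p :
  (const_mx 1 : 'M[R]_(m, n)) *m (const_mx 1 : 'M[R]_(n, p))
  = n%:R *: const_mx 1.
Proof.
apply/matrixP => i j; rewrite !mxE mulr1.
by under eq_bigr => k _ do rewrite !mxE mulr1; rewrite sumr_const card_ord.
Qed.

(** The squared Frobenius norm of [S *m J] is the trace of [J (n - J) J], which
    vanishes because [J *m J = n J]. *)
Lemma conference_mx_const1 (R : rcfType) n (S : 'M[R]_n) :
  S^T = S -> S *m S = n%:R%:M - const_mx 1 -> S *m const_mx 1 = 0 :> 'M_n.
Proof.
move=> symS SS; apply: mxtrace_trmx_mul_eq0.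
rewrite trmx_mul symS trmx_const !mulmxA -(mulmxA (const_mx 1)) SS.
rewrite mulmxBr mulmxBl mul_mx_scalar -scalemxAl mulmx_const1.
by rewrite -scalemxAl mulmx_const1 subrr raddf0.
Qed.

Lemma mxtrace_const1 (R : pzSemiRingType) n : \tr (const_mx 1 : 'M[R]_n) = n%:R.
Proof.
by rewrite /mxtrace; under eq_bigr => i _ do rewrite mxE; rewrite sumr_const card_ord.
Qed.

Lemma mxtrace_sum_diff (R : rcfType) n (V U A B : 'M[R]_n) :
  \tr ((V + U) *m A) + \tr ((V - U) *m B)
  = \tr (V *m (A + B)) + \tr (U *m (A - B)).
Proof. by rewrite mulmxBl mulmxDl mulmxBr mulmxDr !raddfB !raddfD /=; ring. Qed.

Lemma mulmx_sum_diff (R : rcfType) n (X Y : 'M[R]_n) :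
    X *m X = 1%:M -> Y *m Y = 1%:M ->
  let V := 2^-1 *: (X + Y) in let U := 2^-1 *: (X - Y) in
  V *m V + U *m U = 1%:M /\ V *m U = - (U *m V).
Proof.
move=> XX YY V U; rewrite /V /U -!scalemxAl -!scalemxAr !scalerA.
rewrite !(mulmxBr, mulmxBl, mulmxDl, mulmxDr) XX YY.
move: (X *m Y) (Y *m X) => P Q; split; apply/matrixP => i j.
  by rewrite !mxE; field.
by rewrite !mxE; field.
Qed.

(** Equality forces both inequalities of the argument to be equalities:
    [S = sqrt n U] from the Frobenius norm, and [V = J / n] from
    [anticommuting_bound]. *)
Lemma sum_trace_norm_le (R : rcfType) n (A B : 'M[R]_n) :
    (5 <= n)%N -> A^T = A -> B^T = B -> A + B = const_mx 1 - 1%:M ->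
    \tr ((A - B) *m (A - B)) = n%:R * (n%:R - 1) ->
  trace_norm A + trace_norm B <= (n%:R - 1) * (1 + Num.sqrt n%:R) /\
  (trace_norm A + trace_norm B = (n%:R - 1) * (1 + Num.sqrt n%:R) ->
   (A - B) *m (A - B) = n%:R%:M - const_mx 1).
Proof.
move=> n_ge5 symA symB sumAB.
set r := Num.sqrt n%:R; pose N : R := n%:R; rewrite -/N.
have symS : (A - B)^T = A - B by rewrite trmxB symA symB.
move diffAB : (A - B) symS => S symS trSS.
have N_ge5 : 5 <= N by rewrite ler_nat.
have NE : N = r ^+ 2 by rewrite sqr_sqrtr // ler0n.
have r_ge0 : 0 <= r by exact: sqrtr_ge0.
have r_gt2 : 2 < r by nra.
have r_neq0 : r != 0 by rewrite gt_eqF // (lt_trans _ r_gt2).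
have N_neq0 : N != 0 by rewrite gt_eqF // (lt_le_trans _ N_ge5).
pose J : 'M[R]_n := const_mx 1.
have symJ : J^T = J by exact: trmx_const.
have JJ : J *m J = N *: J by exact: mulmx_const1.
have trJ : \tr J = N by exact: mxtrace_const1.
have [X [symX XX <-]] := trace_norm_attained symA.
have [Y [symY YY <-]] := trace_norm_attained symB.
pose V := 2^-1 *: (X + Y); pose U := 2^-1 *: (X - Y).
have [sqVU antiVU] := mulmx_sum_diff XX YY; rewrite -/V -/U in sqVU antiVU.
have symV : V^T = V by rewrite /V trmxZ trmxD symX symY.
have symU : U^T = U by rewrite /U trmxZ trmxB symX symY.
have XE : X = V + U by apply/matrixP => i j; rewrite !mxE; field.
have YE : Y = V - U by apply/matrixP => i j; rewrite !mxE; field.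
clearbody V U.
rewrite XE YE mxtrace_sum_diff sumAB diffAB mulmxBr mulmx1 raddfB /= -/J.
have [||] := anticommuting_bound (c := r / 2) symV symU sqVU antiVU n_ge5.
- by lra.
- by rewrite -/N NE; nra.
rewrite -/N -/J.
set F := _ - _ - _ => F_le F_eq.
have trUU : \tr (U *m U) = N - \tr (V *m V).
  by rewrite -[N](@mxtrace1 R n) -sqVU raddfD /= addrAC subrr add0r.
pose P := \tr ((S - r *: U)^T *m (S - r *: U)).
have P_ge0 : 0 <= P by exact: mxtrace_trmx_mul_ge0.
have PE : P = N * (N - 1) - 2 * r * \tr (U *m S) + N * (N - \tr (V *m V)).
  rewrite -trSS -trUU NE /P trmxB trmxZ symS symU mulmxBl !mulmxBr.
  rewrite -!scalemxAl -!scalemxAr !raddfB /= !mxtraceZ (mxtrace_mulC S U).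
  by ring.
have -> : \tr (V *m J) - \tr V + \tr (U *m S)
          = F + r * (N - 1) - P / (2 * r).
  by rewrite PE /F NE; field; exact: r_neq0.
have Pr_ge0 : 0 <= P / (2 * r) by rewrite divr_ge0 // mulr_ge0.
split; first by lra.
move=> eq_bound.
have /F_eq [trVJ trVV] : F = N - 1 by lra.
have /eqP : P / (2 * r) = 0 by lra.
rewrite mulf_eq0 invr_eq0 mulf_eq0 (negPf r_neq0) pnatr_eq0 !orbF => /eqP P0.
have /eqP := mxtrace_trmx_mul_eq0 P0; rewrite subr_eq0 => /eqP SE.
have VE : V = N^-1 *: J.
  apply/eqP; rewrite -subr_eq0; apply/eqP/mxtrace_trmx_mul_eq0.
  rewrite trmxB trmxZ symV symJ mulmxBl !mulmxBr -!scalemxAl -!scalemxAr.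
  rewrite !raddfB /= !mxtraceZ (mxtrace_mulC J V) JJ mxtraceZ trJ trVJ trVV.
  by field; exact: N_neq0.
rewrite SE -scalemxAl -scalemxAr scalerA -expr2 -NE.
have -> : U *m U = 1%:M - V *m V by rewrite -sqVU addrC addKr.
rewrite VE -scalemxAl -scalemxAr JJ !scalerA scalerBr scalerA.
rewrite scale_scalar_mx mulr1; congr (_ - _).
by rewrite -[RHS]scale1r; congr (_ *: _); field; exact: N_neq0.
Qed.

(** The eigenvalues of [S] are 0, on the all-ones vector, and the two square
    roots of [n]; so [V = J / n] and [U = S / sqrt n] satisfy the relations that
    make [V + U] and [V - U] involutions. *)
Lemma conference_mx_sum_trace_norm_ge (R : rcfType) n (A B : 'M[R]_n) :
    (0 < n)%N -> A^T = A -> B^T = B -> A + B = const_mx 1 - 1%:M ->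
    (A - B) *m (A - B) = n%:R%:M - const_mx 1 ->
  (n%:R - 1) * (1 + Num.sqrt n%:R) <= trace_norm A + trace_norm B.
Proof.
move=> n_gt0 symA symB sumAB.
set r := Num.sqrt n%:R; pose N : R := n%:R; rewrite -/N.
have symS : (A - B)^T = A - B by rewrite trmxB symA symB.
move diffAB : (A - B) symS => S symS.
pose J : 'M[R]_n := const_mx 1; rewrite -/J => SS.
have N_gt0 : 0 < N by rewrite ltr0n.
have NE : N = r ^+ 2 by rewrite sqr_sqrtr // ltW.
have r_neq0 : r != 0 by rewrite gt_eqF // sqrtr_gt0.
have symJ : J^T = J by exact: trmx_const.
have JJ : J *m J = N *: J by exact: mulmx_const1.
have trJ : \tr J = N by exact: mxtrace_const1.
have SJ : S *m J = 0 by exact: conference_mx_const1.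
have JS : J *m S = 0 by rewrite -[LHS]trmxK trmx_mul symS symJ SJ trmx0.
have trSS : \tr (S *m S) = N * N - N.
  by rewrite SS raddfB /= trJ mxtrace_scalar mulr_natr.
pose V := N^-1 *: J; pose U := r^-1 *: S.
have VU : V *m U = 0 by rewrite /V /U -scalemxAl -scalemxAr JS !scaler0.
have UV : U *m V = 0 by rewrite /V /U -scalemxAl -scalemxAr SJ !scaler0.
have symV : V^T = V by rewrite trmxZ symJ.
have symU : U^T = U by rewrite trmxZ symS.
have sqVU : V *m V + U *m U = 1%:M.
  rewrite /V /U -!scalemxAl -!scalemxAr JJ SS !scalerA scalerBr.
  rewrite scale_scalar_mx NE; apply/matrixP => i j; rewrite !mxE.
  by case: (i == j); rewrite ?mulr1n ?mulr0n; field.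
have orthX : orthogonal_mx (V + U).
  by rewrite /orthogonal_mx trmxD symV symU mulmxDl !mulmxDr VU UV addr0 add0r.
have orthY : orthogonal_mx (V - U).
  rewrite /orthogonal_mx trmxB symV symU mulmxBl !mulmxBr VU UV.
  by rewrite subr0 sub0r opprK.
have := lerD (mxtrace_le_trace_norm symA orthX) (mxtrace_le_trace_norm symB orthY).
rewrite mxtrace_sum_diff sumAB diffAB -/J mulmxBr mulmx1 raddfB /=.
rewrite -!scalemxAl !mxtraceZ JJ mxtraceZ trJ trSS.
by congr (_ <= _); rewrite NE; field.
Qed.

Theorem sum_trace_norm_bound (R : rcfType) n (A B : 'M[R]_n) :
    (5 <= n)%N -> A^T = A -> B^T = B -> A + B = const_mx 1 - 1%:M ->
    \tr ((A - B) *m (A - B)) = n%:R * (n%:R - 1) ->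
  trace_norm A + trace_norm B <= (n%:R - 1) * (1 + Num.sqrt n%:R) /\
  (trace_norm A + trace_norm B = (n%:R - 1) * (1 + Num.sqrt n%:R)
   <-> (A - B) *m (A - B) = n%:R%:M - const_mx 1).
Proof.
move=> n_ge5 symA symB sumAB trSS.
have [le_bound eq_bound] := sum_trace_norm_le n_ge5 symA symB sumAB trSS.
split=> //; split=> // SS; apply: le_anti; rewrite le_bound /=.
by apply: conference_mx_sum_trace_norm_ge => //; exact: leq_trans n_ge5.
Qed.

(** * Conference graphs *)

Lemma entryD (V : nmodType) m n (M N : 'M[V]_(m, n)) i j :
  (M + N) i j = M i j + N i j.
Proof. exact: mxE. Qed.

Lemma entryN (V : zmodType) m n (M : 'M[V]_(m, n)) i j : (- M) i j = - M i j.
Proof. exact: mxE. Qed.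

Lemma card_common_neighboursxx (G : sgraph) (u : vertex G) :
  #|common_neighbours u u| = #|[set w | adj G u w]|.
Proof. by apply: eq_card => w; rewrite !inE andbb. Qed.

Section Adjacency.

Variables (R : rcfType) (G : sgraph).
Let n := graph_order G.
Let A : 'M[R]_n := adjacency_matrix R G.
Let B : 'M[R]_n := adjacency_matrix R (complement G).
Let deg (u : vertex G) := #|[set w | adj G u w]|.

Lemma adjacency_matrix_sym : A^T = A.
Proof. by apply/matrixP => i j; rewrite !mxE adj_sym. Qed.

Lemma adjacency_matrix_complement : A + B = const_mx 1 - 1%:M.
Proof.
apply/matrixP => i j; rewrite !mxE /= /compl_adj (inj_eq enum_val_inj).
case: eqVneq => [->|_] /=; first by rewrite adj_irrefl subrr addr0.
by case: adj; rewrite /= ?addr0 ?add0r subr0.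
Qed.

Lemma adjacency_matrix_diff : A - B = A *+ 2 + 1%:M - const_mx 1.
Proof.
have -> : B = const_mx 1 - 1%:M - A.
  by rewrite -adjacency_matrix_complement addrAC subrr add0r.
by rewrite opprB addrA -mulr2n opprB addrA.
Qed.

Lemma sum_enum_val (f : pred (vertex G)) :
  \sum_(k < n) (f (enum_val k))%:R = #|f|%:R :> R.
Proof.
rewrite -sum1_card natr_sum [RHS]big_mkcond.
rewrite [RHS](reindex _ (onW_bij _ (enum_val_bij _))).
by apply: eq_bigr => k _; rewrite unfold_in; case: (f _).
Qed.

Lemma mul_adjacency_const1 i j :
  (A *m const_mx 1 : 'M_n) i j = (deg (enum_val i))%:R.
Proof.
rewrite mxE /deg cardsE -sum_enum_val.
by apply: eq_bigr => k _; rewrite !mxE mulr1.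
Qed.

Lemma mul_adjacency_adjacency i j :
  (A *m A) i j = #|common_neighbours (enum_val i) (enum_val j)|%:R.
Proof.
rewrite mxE /common_neighbours cardsE -sum_enum_val.
by apply: eq_bigr => k _; rewrite !mxE -natrM mulnb [adj G (enum_val j) _]adj_sym.
Qed.

Lemma mul_diff_const1 i j :
  ((A - B) *m const_mx 1 : 'M_n) i j = (2 * deg (enum_val i) + 1)%:R - n%:R.
Proof.
rewrite adjacency_matrix_diff mulr2n !mulmxDl mulNmx mul1mx mulmx_const1.
rewrite !entryD entryN mul_adjacency_const1 !mxE.
by ring.
Qed.

(** Natural numbers are kept on both sides of the subtraction, so that the
    equations for the entries of [(A - B) *m (A - B)] become equations in [nat]. *)
Lemma mul_diff_diff i j :
  ((A - B) *m (A - B)) i j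
  = (4 * #|common_neighbours (enum_val i) (enum_val j)|
     + 4 * adj G (enum_val i) (enum_val j) + (i == j) + n)%:R
    - (2 * deg (enum_val i) + 2 * deg (enum_val j) + 2)%:R.
Proof.
have constA : (const_mx 1 *m A : 'M_n) i j = (deg (enum_val j))%:R.
  by rewrite -[A]adjacency_matrix_sym -trmx_const -trmx_mul mxE mul_adjacency_const1.
have diffA : ((A - B) *m A) i j
    = 2 * #|common_neighbours (enum_val i) (enum_val j)|%:R
      + (adj G (enum_val i) (enum_val j))%:R - (deg (enum_val j))%:R.
  rewrite adjacency_matrix_diff mulr2n !mulmxDl mulNmx mul1mx.
  rewrite !entryD entryN constA !mul_adjacency_adjacency.
  by rewrite [A i j]mxE; ring.
have diffE : (A - B) i j
    = 2 * (adj G (enum_val i) (enum_val j))%:R + (i == j)%:R - 1.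
  by rewrite adjacency_matrix_diff mulr2n !mxE; ring.
have diff1 := mul_diff_const1 i j.
rewrite [X in _ *m X]adjacency_matrix_diff mulr2n.
move: (A - B) diffA diffE diff1 => D diffA diffE diff1.
rewrite mulmxBr !mulmxDr mulmx1 !entryD entryN diff1 diffA diffE.
by ring.
Qed.

Lemma mxtrace_mul_diff_diff :
  \tr ((A - B) *m (A - B)) = n%:R * (n%:R - 1).
Proof.
rewrite /mxtrace (eq_bigr (fun=> n%:R - 1)) => [|i _].
  by rewrite sumr_const card_ord mulr_natl.
by rewrite mul_diff_diff eqxx adj_irrefl card_common_neighboursxx /=; ring.
Qed.

End Adjacency.

(** Since [S *m J = 0] by [conference_mx_const1], the graph is regular of degree
    [(n - 1) / 2]; the off-diagonal entries of [S *m S] then fix the numbers of common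
    neighbours.  Divisibility of [n - 5] and [n - 1] by 4 comes from one pair of
    adjacent vertices. *)
Lemma conference_graphP (R : rcfType) (G : sgraph) (n := graph_order G)
    (S := adjacency_matrix R G - adjacency_matrix R (complement G) : 'M[R]_n) :
  (1 < n)%N -> S *m S = n%:R%:M - const_mx 1 <-> conference_graph n G.
Proof.
move=> n_gt1.
have rankK (u : vertex G) : enum_val (enum_rank u : 'I_n) = u.
  exact: enum_rankK.
have entry_eq i j : ((n%:R%:M - const_mx 1 : 'M[R]_n) i j) = (n * (i == j))%:R - 1%:R.
  by rewrite !mxE; case: eqP => _; rewrite ?muln1 ?muln0.
split=> [SS|[d [l [m [[_ reg adj_l nadj_m] d_n l_n m_n]]]]].
  have symS : S^T = S.
    rewrite /S trmxB (adjacency_matrix_sym R G).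
    by rewrite [X in _ - X](adjacency_matrix_sym R (complement G)).
  have S1 := conference_mx_const1 symS SS.
  have deg_n u : (2 * #|[set w | adj G u w]| + 1 = n)%N.
    move/matrixP: S1 => /(_ (enum_rank u) (enum_rank u)).
    rewrite mul_diff_const1 mxE rankK => /eqP.
    by rewrite subr_eq0 eqr_nat => /eqP.
  have cn_n u v : u != v -> (4 * #|common_neighbours u v| + 4 * adj G u v + 1 = n)%N.
    move=> neq_uv; move/matrixP: SS => /(_ (enum_rank u) (enum_rank v)).
    rewrite mul_diff_diff entry_eq !rankK (inj_eq enum_rank_inj) (negPf neq_uv).
    move=> /eqP; rewrite subr_eq addrAC eq_sym subr_eq -!natrD eqr_nat => /eqP.
    by have := deg_n u; have := deg_n v; lia.
  (* an edge u0 v0 gives lambda, and then mu = lambda + 1 by arithmetic *)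
  pose u0 : vertex G := enum_val (Ordinal (ltnW n_gt1)).
  have /card_gt0P [v0] : (0 < #|[set w | adj G u0 w]|)%N by have := deg_n u0; lia.
  rewrite inE => adj0.
  have neq0 : u0 != v0 by apply: contraTneq adj0 => <-; rewrite adj_irrefl.
  have l_n := cn_n _ _ neq0; rewrite adj0 in l_n.
  exists #|[set w | adj G u0 w]|, #|common_neighbours u0 v0|,
    #|common_neighbours u0 v0|.+1; split; [split=> //|exact: deg_n|lia|lia].
  - by move=> u; have := deg_n u; have := deg_n u0; lia.
  - by move=> u v neq_uv adj_uv; have := cn_n _ _ neq_uv; rewrite adj_uv; lia.
  - by move=> u v neq_uv /negPf adj_uv; have := cn_n _ _ neq_uv; rewrite adj_uv; lia.
apply/matrixP => i j; rewrite mul_diff_diff entry_eq !reg.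
apply/eqP; rewrite subr_eq addrAC eq_sym subr_eq -!natrD eqr_nat; apply/eqP.
have [<-|neq_ij] := eqVneq i j.
  by rewrite card_common_neighboursxx adj_irrefl reg; lia.
have neq_v : enum_val i != enum_val j :> vertex G by rewrite (inj_eq enum_val_inj).
have [adj_ij|nadj_ij] := boolP (adj G (enum_val i) (enum_val j)).
  by rewrite adj_l //; lia.
by rewrite nadj_m //; lia.
Qed.

Theorem theorem1 (R : realType) (n : nat) (G : sgraph)
    (order_G : graph_order G = n) (n_ge7 : (7 <= n)%N) :
  graph_trace_norm R G + graph_trace_norm R (complement G)
    <= (n%:R - 1) * (1 + Num.sqrt n%:R)
  /\ (graph_trace_norm R G + graph_trace_norm R (complement G)
        = (n%:R - 1) * (1 + Num.sqrt n%:R)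
      <-> conference_graph n G).
Proof.
subst n; set n := graph_order G.
pose A : 'M[R]_n := adjacency_matrix R G.
pose B : 'M[R]_n := adjacency_matrix R (complement G).
have [|||||le_bound eq_bound] := @sum_trace_norm_bound R n A B.
- exact: leq_trans n_ge7.
- exact: adjacency_matrix_sym.
- exact: adjacency_matrix_sym (complement G).
- exact: adjacency_matrix_complement.
- exact: mxtrace_mul_diff_diff.
split; first exact: le_bound.
apply: (iff_trans eq_bound); apply: conference_graphP.
exact: leq_trans n_ge7.
Qed.
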